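(* Let $q=2^r$ be such that $r$ admits a proper divisor $s>2$ (i.e. a divisor $s$ of $r$ with $2<s<r$). Then there exists a translation arc $\mathcal{K}$ in $PG(2,q)$ such that: (a) every point in $PG(2,q)\setminus \ell_\infty$ belongs to some secant of $\mathcal{K}$; (b) $\mathcal{K}$ is not contained in any hyperoval of $PG(2,q)$; (c) $\mathcal{K}$ is not contained in any proper subplane of $PG(2,q)$.
   Context: $PG(2,q)$ is the Desarguesian projective plane over $\mathbb{F}_q$, with homogeneous coordinates $(X_1,X_2,X_3)$, and $\ell_\infty$ is the line $X_3=0$. A $k$-arc is a set of $k$ points no three of which are collinear; a hyperoval is a $(q+2)$-arc. A secant of an arc is a line containing two (distinct) points of it. For $A=(a_1,a_2)\in\mathbb{F}_q\times\mathbb{F}_q$ let $\varphi_A:(X_1,X_2,X_3)\mapsto(X_1+a_1X_3,\,X_2+a_2X_3,\,X_3)$. For an additive subgroup $G$ of $\mathbb{F}_q\times\mathbb{F}_q$ and a point $P\in PG(2,q)\setminus\ell_\infty$, let $\mathcal{K}_G(P)=\{\varphi_A(P)\mid A\in G\}$. A translation arc is an arc in $PG(2,q)$ coinciding with $\mathcal{K}_G(P)$ for some additive subgroup $G$ of $\mathbb{F}_q\times\mathbb{F}_q$ and some $P\in PG(2,q)\setminus \ell_\infty$. *)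

(* Defs.v *)
From HB Require Import structures.
From mathcomp Require Import all_boot all_order all_algebra all_field.

Set Implicit Arguments.
Unset Strict Implicit.
Unset Printing Implicit Defensive.

Import GRing.Theory.
Local Open Scope ring_scope.

Section Plane.

Variable F : finFieldType.

Definition row3 (x1 x2 x3 : F) : 'rV[F]_3 := \row_j [:: x1; x2; x3]`_j.

(* A point of PG(2,q) is the set of all its homogeneous coordinate vectors,
   i.e. the set of nonzero scalar multiples of a nonzero vector. *)
Definition coord_class (v : 'rV[F]_3) : {set 'rV[F]_3} :=
  [set c *: v | c : F & c != 0].

Definition is_point (X : {set 'rV[F]_3}) : bool :=
  [exists v : 'rV[F]_3, (v != 0) && (X == coord_class v)].

Record point : Type := Point {
  coords :> {set 'rV[F]_3};
  coordsP : is_point coords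
}.

HB.instance Definition _ := [isSub for coords].
HB.instance Definition _ := [Finite of point by <:].

(* The set of points of the line u_1 X_1 + u_2 X_2 + u_3 X_3 = 0. *)
Definition line (u : 'rV[F]_3) : {set point} :=
  [set P : point | [forall v in coords P, \sum_(j < 3) u 0 j * v 0 j == 0]].

Definition lines : {set {set point}} :=
  [set line u | u : 'rV[F]_3 & u != 0].

Definition line_infty : {set point} := line (row3 0 0 1).

Definition collinear (P Q R : point) : Prop :=
  exists2 l, l \in lines & [&& P \in l, Q \in l & R \in l].

Definition is_arc (K : {set point}) : Prop :=
  forall P Q R, P \in K -> Q \in K -> R \in K ->
    P != Q -> P != R -> Q != R -> ~ collinear P Q R.

Definition is_karc (k : nat) (K : {set point}) : Prop :=
  #|K| = k /\ is_arc K.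

Definition is_hyperoval (K : {set point}) : Prop := is_karc (#|F| + 2) K.

Definition is_secant (K l : {set point}) : Prop :=
  l \in lines /\
  exists P Q, [/\ P \in K, Q \in K, P != Q, P \in l & Q \in l].

(* The coordinates X_1, X_2, X_3 of v are v 0 0, v 0 1, v 0 2. *)
Definition phi_vec (A : F * F) (v : 'rV[F]_3) : 'rV[F]_3 :=
  row3 (v 0 0 + A.1 * v 0 2) (v 0 1 + A.2 * v 0 2) (v 0 2).

Lemma phi_vecZ A c v : phi_vec A (c *: v) = c *: phi_vec A v.
Proof.
apply/rowP => -[[|[|[|//]]] ?]; rewrite !mxE /= ?mulrDr //; congr (_ + _);
  by rewrite mulrCA.
Qed.

Lemma phi_vecK A : cancel (phi_vec A) (phi_vec (- A)).
Proof.
move=> v; apply/rowP => -[[|[|[|//]]] i3]; rewrite !mxE /= ?mulNr ?addrK;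
  by congr (v _ _); apply: val_inj.
Qed.

Lemma phi_is_point A (P : point) : is_point [set phi_vec A v | v in coords P].
Proof.
case: P => X /= /existsP[v /andP[v0 /eqP->]]; apply/existsP; exists (phi_vec A v).
apply/andP; split.
  have phi0 : phi_vec (- A) 0 = 0 by rewrite -[0](scale0r 0) phi_vecZ !scale0r.
  by apply: contra_neq v0 => e; rewrite -(phi_vecK A v) e phi0.
rewrite /coord_class -imset_comp; apply/eqP/eq_imset => c /=.
exact: phi_vecZ.
Qed.

Definition phi (A : F * F) (P : point) : point := Point (phi_is_point A P).

Definition translation_orbit (G : {set F * F}) (P : point) : {set point} :=
  [set phi A P | A in G].

Definition is_translation_arc (K : {set point}) : Prop :=
  is_arc K /\
  exists (G : {set F * F}) (P : point),
    [/\ zmod_closed G, P \notin line_infty & K = translation_orbit G P].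

(* The axioms of a projective plane for the points S and the lines L, a point
   being incident with a line when it belongs to it; lines of L may have
   points outside S. *)
Definition is_projective_plane (T : finType) (S : {set T}) (L : {set {set T}}) :
    Prop :=
  [/\ forall P Q, P \in S -> Q \in S -> P != Q ->
        exists! l, [/\ l \in L, P \in l & Q \in l],
      forall l m, l \in L -> m \in L -> l != m ->
        exists! P, [/\ P \in S, P \in l & P \in m]
    & exists2 Q : {set T}, Q \subset S /\ #|Q| = 4%N
        & forall l, l \in L -> (#|Q :&: l| <= 2)%N].

Definition is_subplane (S : {set point}) (L : {set {set point}}) : Prop :=
  L \subset lines /\ is_projective_plane S L.

Definition is_proper_subplane (S : {set point}) (L : {set {set point}}) : Prop :=
  is_subplane S L /\ S \proper [set: point].

End Plane.

(* Main.v *)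
(* A subgroup G of F^2 gives an arc exactly when any two distinct nonzero elements
   of G are F-independent. If a point u lies on no secant of G, then G + {0, u}
   again gives an arc, so an inclusion-maximal G satisfies (a). By (a) a hyperoval
   containing the arc has its further points, at most two of them, at infinity, so
   (b) only requires |G| < q.
   A subgroup G of order q misses two directions, hence in suitable coordinates is
   the graph of an additive f with x |-> f x / x injective; by Payne's theorem f is
   a x^(2^i). If G contains (0,0), (1,0), (0,1), (w,w^2) and (v,v^2), this forces
   w + v to be 0 or 1. It thus suffices to start from a subgroup of order 16
   generated by such points with w + v not in F_2: choose w of multiplicative order
   q - 1, and v by counting (q >= 64).
   Finally a subplane through (0,0), (1,0), (0,1), (1,1), (w,w^2) contains all
   points (w^k,0), hence the whole plane, which is (c). *)

Require Import Defs.
From HB Require Import structures.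
From mathcomp Require Import all_boot all_order all_algebra.
From mathcomp Require Import all_fingroup all_solvable all_field.
From mathcomp Require Import ring zify.

Set Implicit Arguments.
Unset Strict Implicit.
Unset Printing Implicit Defensive.

Import GRing.Theory.
Local Open Scope ring_scope.

(** * Sums of powers of two *)

Section PowersOfTwo.
Local Open Scope nat_scope.

Lemma sum_pow2_iota n : (\sum_(t <- iota 0 n) 2 ^ t).+1 = 2 ^ n.
Proof.
elim: n => [|n IHn]; first by rewrite big_nil.
rewrite -[in iota _ _]addn1 iotaD add0n big_cat big_seq1 /= -addSn IHn.
by rewrite addnn expnS mul2n.
Qed.

Lemma sum_pow2_uniq n (T : seq nat) :
  uniq T -> {subset T <= iota 0 n} ->
  perm_eq T (iota 0 n) \/ (\sum_(t <- T) 2 ^ t).+1 < 2 ^ n.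
Proof.
move=> uT sT; have uI := iota_uniq 0 n.
have [/allP sI|/allPn[t tI tT]] := boolP (all (mem T) (iota 0 n)).
  by left; apply: uniq_perm => // t; apply/idP/idP => [/sT|/sI].
right; rewrite -sum_pow2_iota ltnS [X in _ < X](bigID (mem T)) /=.
rewrite -[X in _ < X + _]big_filter [X in _ < X + _](perm_big T) /=; last first.
  apply: uniq_perm => [||z]; rewrite ?filter_uniq // mem_filter.
  by have [/sT|] := boolP (z \in T).
by rewrite [X in _ + X](big_rem t) //= tT -addn1 leq_add2l addn_gt0 expn_gt0.
Qed.

Lemma pow2_modn r e : 2 ^ e = 2 ^ (e %% r) %[mod (2 ^ r).-1].
Proof.
have r1 : 2 ^ r = 1 %[mod (2 ^ r).-1].
  have: 0 < 2 ^ r by rewrite expn_gt0.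
  by case: (2 ^ r) => [//|p] _; rewrite -[p.+1.-1]/p -addn1 modnDl.
rewrite {1}(divn_eq e r) expnD [_ * r]mulnC expnM -modnMml -modnXm r1.
by rewrite modnXm exp1n modnMml mul1n.
Qed.

(* Merging two equal powers of two gives a shorter sum with the same residue,
   whereas a sum of distinct ones is its own residue. *)
Lemma sum_pow2_modn r m (T : seq nat) :
    0 < m < r -> size T <= m -> all (ltn^~ r) T ->
    \sum_(t <- T) 2 ^ t = (2 ^ m).-1 %[mod (2 ^ r).-1] ->
  perm_eq T (iota 0 m).
Proof.
move=> /andP[m0 mr]; have [n] := ubnP (size T).
elim: n T => // n IHn T /ltnSE sTn sTm /allP Tr ET.
have m2r : 2 ^ m < 2 ^ r by rewrite ltn_exp2l.
have [uT|nuT] := boolP (uniq T).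
  have sTI : {subset T <= iota 0 r} by move=> t /Tr; rewrite mem_iota.
  (* At most [m < r] exponents cannot exhaust those below [r], so both sides are below the modulus
     and the congruence is an equality. *)
  have {ET} ET : (\sum_(t <- T) 2 ^ t).+1 = 2 ^ m.
    have [/perm_size|ltT] := sum_pow2_uniq uT sTI.
      by rewrite size_iota => E; move: sTm mr; rewrite E; lia.
    move: ET; rewrite !modn_small ?prednK ?expn_gt0 //; last by lia.
      by move->; rewrite prednK ?expn_gt0.
    have := expn_gt0 2 m; lia.
  have sTm' : {subset T <= iota 0 m}.
    move=> t tT; rewrite mem_iota leq0n add0n -(ltn_exp2l t m (isT : 1 < 2)) -ET.
    by rewrite ltnS (big_rem t) //= leq_addr.
  by have [//|] := sum_pow2_uniq uT sTm'; rewrite ET ltnn.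
have [t [T' pT]] : exists t T', perm_eq T [:: t, t & T'].
  elim: T nuT {sTn sTm Tr ET} => //= x s IHs; rewrite negb_and negbK.
  case/orP=> [xs|/IHs[t [T' pT]]].
    by exists x, (rem x s); rewrite perm_cons perm_to_rem.
  exists t, (x :: T'); rewrite (perm_trans (y := [:: x, t, t & T'])) ?perm_cons //.
  by rewrite -[[:: x, t, t & T']]/([:: x] ++ [:: t; t] ++ T') perm_catCA.
(* By induction the merged list has length exactly [m], so [T] would have [m + 1] elements. *)
have : perm_eq ((t.+1 %% r) :: T') (iota 0 m).
  have := perm_size pT => /= sT.
  apply: IHn => /=; rewrite -?sT //; try lia.
    rewrite ltn_mod; apply/andP; split; first by lia.
    by apply/allP => z zT; apply: Tr; rewrite (perm_mem pT) !inE zT !orbT.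
  rewrite big_cons -modnDml -pow2_modn modnDml -ET (perm_big _ pT) /=.
  by rewrite !big_cons expnS mul2n -addnn addnA.
move/perm_size; rewrite /= size_iota => E.
by move: (perm_size pT) sTm => /= ->; rewrite -E ltnn.
Qed.

(** By [sum_pow2_modn] the residues of [t j + j] modulo [r] permute the integers below
    [m = i + (r - M)]. Going down from [j = r - M - 1], then up from [j = r - M], any other value of
    [t j] leaves this range or repeats a residue already taken. *)
Lemma forced_exponents r i M (t : nat -> nat) :
    i < M < r -> (forall j, j < i + (r - M) -> i <= t j <= M) ->
    \sum_(j <- iota 0 (i + (r - M))) 2 ^ (t j + j)
      = (2 ^ (i + (r - M))).-1 %[mod (2 ^ r).-1] ->
  forall j, j < i + (r - M) -> t j = if j < r - M then i else M.
Proof.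
move=> iMr; set l := r - M; set m := i + l => tb Et.
have [El Em] : l = r - M /\ m = i + l by [].
have {Et} pT : perm_eq [seq (t j + j) %% r | j <- iota 0 m] (iota 0 m).
  apply: (@sum_pow2_modn r); rewrite ?size_map ?size_iota //; first by lia.
    by apply/allP => _ /mapP[j _ ->] /=; rewrite ltn_mod; lia.
  rewrite -{}Et big_map; elim: (iota 0 m) => [|j s IHs]; first by rewrite !big_nil.
  by rewrite !big_cons -modnDm -pow2_modn IHs modnDm.
have um j : j < m -> (t j + j) %% r < m.
  move=> jm; have := perm_mem pT ((t j + j) %% r).
  rewrite [X in _ = X]mem_iota leq0n add0n /= => <-.
  by apply/mapP; exists j; rewrite ?mem_iota.
have ui j k : j < m -> k < m -> (t j + j) %% r = (t k + k) %% r -> j = k.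
  have /(uniqP 0) uT : uniq [seq (t j + j) %% r | j <- iota 0 m].
    by rewrite (perm_uniq pT) iota_uniq.
  move=> jm km E; apply: uT; rewrite ?inE ?size_map ?size_iota //.
  by rewrite !(nth_map 0) ?size_iota // !nth_iota.
have uf j : j < l -> (t j + j) %% r = t j + j.
  move=> jl; have tj : i <= t j <= M by apply: tb; lia.
  by rewrite modn_small //; lia.
have ub j : l <= j -> j < m -> (t j + j) %% r = t j + j - r.
  move=> lj jm; have tj := tb j jm; have := um j jm.
  have [tr|rt] := ltnP (t j + j) r; first by rewrite modn_small //; lia.
  by move=> _; rewrite -{1}(subnK rt) modnDr modn_small //; lia.
have forw p : p < l -> t (l - p.+1) = i.
  have [n] := ubnP p; elim: n p => // n IHn p /ltnSE pn pl.
  have jm : l - p.+1 < m by lia.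
  have := um _ jm; have := tb _ jm; rewrite uf; last by lia.
  move=> tj ujm; apply/eqP; rewrite eqn_leq; apply/andP; split; last by lia.
  rewrite leqNgt; apply/negP => it.
  pose p' := l - (t (l - p.+1) + (l - p.+1) - i).+1.
  have p'p : p' < p by lia.
  have tp' : t (l - p'.+1) = i by apply: IHn; lia.
  suff : l - p'.+1 = l - p.+1 by lia.
  by apply: ui; rewrite ?uf ?tp'; lia.
have back p : p < i -> t (l + p) = M.
  have [n] := ubnP p; elim: n p => // n IHn p /ltnSE pn pl.
  have jm : l + p < m by lia.
  have := um _ jm; have := tb _ jm; rewrite ub //; last by lia.
  move=> tj ujm; apply/eqP; rewrite eqn_leq; apply/andP; split; first by lia.
  rewrite leqNgt; apply/negP => tM.
  have [lt_r|ge_r] := ltnP (t (l + p) + (l + p)) r.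
    by have := um _ jm; rewrite modn_small //; lia.
  pose p' := t (l + p) + (l + p) - r.
  have p'p : p' < p by lia.
  have tp' : t (l + p') = M by apply: IHn; lia.
  suff : l + p' = l + p by lia.
  by apply: ui; rewrite ?ub ?tp'; lia.
move=> j jm; case: ifP => jl.
  by rewrite -(forw (l - j.+1)); [congr t | ]; lia.
by rewrite -(back (j - l)); [congr t | ]; lia.
Qed.

(** The exponents with [j < r - M] run from [i] to [i + (r - M) - 1]; the others run from [r] to
    [r + i - 1] and reduce to [0, ..., i - 1]. *)
Lemma sum_forced_exponents r i M :
    M < r ->
  \sum_(j <- iota 0 (i + (r - M))) 2 ^ ((if j < r - M then i else M) + j)
    = (2 ^ (i + (r - M))).-1 %[mod (2 ^ r).-1].
Proof.
move=> Mr; set l := r - M; have El : l + M = r by rewrite /l; lia.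
rewrite addnC -(sum_pow2_iota (l + i)) succnK.
have r_mod : \sum_(j <- iota 0 i) 2 ^ (r + j)
           = \sum_(j <- iota 0 i) 2 ^ j %[mod (2 ^ r).-1].
  elim: (iota 0 i) => [|j s IHs]; first by rewrite !big_nil.
  by rewrite !big_cons -modnDm IHs pow2_modn modnDl -pow2_modn modnDm.
transitivity ((\sum_(j <- iota 0 l) 2 ^ (i + j) +
                 \sum_(j <- iota 0 i) 2 ^ (r + j)) %% (2 ^ r).-1); last first.
  rewrite -modnDmr r_mod modnDmr [l + i]addnC iotaD big_cat /=.
  rewrite [X in X %% _]addnC; congr ((_ + _) %% _).
  have -> : iota (0 + i) l = map (addn i) (iota 0 l) by rewrite -iotaDl addn0.
  by rewrite big_map.
congr (_ %% _).
have -> : iota 0 (l + i) = iota 0 l ++ map (addn l) (iota 0 i).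
  by rewrite iotaD -iotaDl addn0.
rewrite big_cat big_map /=; congr (_ + _).
  rewrite big_seq [RHS]big_seq; apply: eq_bigr => j.
  by rewrite mem_iota add0n => /andP[_ ->].
by apply: eq_bigr => j _; rewrite ltnNge leq_addr /= addnA [M + l]addnC El.
Qed.

End PowersOfTwo.

(** * Additive o-polynomials *)

Lemma finField_primitive (F : finFieldType) :
  exists z : F, (#|F|.-1).-primitive_root z.
Proof.
have q1 := finNzRing_gt1 F.
have /hasP[z _ zP] : has (#|F|.-1).-primitive_root (enum (predC1 (0 : F))).
  apply: has_prim_root; rewrite ?enum_uniq -?cardE ?cardC1 -?subn1 ?subn_gt0 //.
  apply/allP=> x; rewrite mem_enum /= inE => x0; rewrite /= unity_rootE subn1.
  by apply/eqP/(mulfI x0); rewrite -exprS prednK ?expf_card ?mulr1 ?(ltnW q1).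
by exists z.
Qed.

Lemma prim_root_neq0 (F : finFieldType) n (z : F) : n.-primitive_root z -> z != 0.
Proof.
move=> zP; apply/eqP => z0; have := prim_expr_order zP; rewrite z0 expr0n.
by rewrite gtn_eqF ?(prim_order_gt0 zP) // => /esym/eqP; rewrite oner_eq0.
Qed.

(** Scaling by a primitive element [z] permutes [F] and multiplies the sum by [z ^+ k], so the sum
    vanishes unless [z ^+ k = 1]. In that case each nonzero [x] contributes 1. *)
Lemma sum_exprE (F : finFieldType) k : (0 < k)%N ->
  \sum_(x : F) x ^+ k = if (#|F|.-1 %| k)%N then -1 else 0.
Proof.
move=> k0; have q0 := ltnW (finNzRing_gt1 F).
have [z zP] := finField_primitive F.
have z0 := prim_root_neq0 zP.
case: ifP => [/dvdnP[j Ek]|nk].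
  have qF : #|F|%:R = 0 :> F.
    apply: (addrI (\sum_(x : F) x)); rewrite addr0 -sumr_const -big_split /=.
    by rewrite [RHS](reindex_inj (addIr 1)).
  have -> : -1 = #|F|.-1%:R :> F.
    by apply/eqP; rewrite eq_sym -addr_eq0 -mulrSr prednK ?qF.
  rewrite (bigD1 0) //= expr0n gtn_eqF //= add0r.
  rewrite (eq_bigr (fun _ => 1)) => [|x x0]; first by rewrite sumr_const cardC1.
  have xq : x ^+ #|F|.-1 = 1.
    by apply: (mulfI x0); rewrite mulr1 -exprS prednK ?expf_card.
  by rewrite Ek mulnC exprM xq expr1n.
have : (z ^+ k - 1) * \sum_(x : F) x ^+ k = 0.
  rewrite mulrBl mul1r mulr_sumr; apply/eqP; rewrite subr_eq0; apply/eqP.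
  rewrite [RHS](reindex_inj (mulfI z0)); apply: eq_bigr => x _.
  by rewrite exprMn.
by move/eqP; rewrite mulf_eq0 subr_eq0 -(prim_order_dvd zP) nk => /eqP.
Qed.

Section Payne.

Variables (F : finFieldType) (r : nat).
Hypothesis cardF : #|F| = (2 ^ r)%N.

Lemma char2 : 2%N \in [pchar F].
Proof. exact: card_finPcharP cardF _. Qed.

Lemma expr_pow2D j : {morph (fun x : F => x ^+ (2 ^ j)) : x y / x + y}.
Proof.
move=> x y; apply: exprDn_pchar.
by rewrite (eq_pnat _ (pcharf_eq char2)) pnatX.
Qed.

Lemma expr_pow2_sum j I (s : seq I) (E : I -> F) :
  (\sum_(i <- s) E i) ^+ (2 ^ j) = \sum_(i <- s) E i ^+ (2 ^ j).
Proof. by apply: (big_morph _ (expr_pow2D j)); rewrite expr0n expn_eq0. Qed.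

(* The Moore matrix of a basis of F over F_2 is invertible: a linear relation
   between its rows is a polynomial of degree less than #|F| vanishing on F. *)
Lemma additive_linearized (f : F -> F) : {morph f : x y / x + y} ->
  exists a : 'I_r -> F, forall x, f x = \sum_(i < r) a i * x ^+ (2 ^ i).
Proof.
move=> fD.
have f0 : f 0 = 0 by apply: (addrI (f 0)); rewrite -fD !addr0.
(* [b] is a basis of [F] over its prime field of order 2, so the coordinates can be booleans. *)
have [b bP] : exists b : 'I_r -> F,
    forall x, exists c : 'I_r -> bool, x = \sum_(j < r) b j *+ c j.
  pose V := pPrimeCharType char2.
  have dV : \dim {: V} = r by rewrite pprimeChar_dimf cardF pfactorK.
  exists (fun j => (vbasis {: V})`_j : V) => x.
  exists (fun j => coord (vbasis {: V}) (cast_ord (esym dV) j) (x : V) != 0).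
  rewrite {1}(coord_vbasis (memvf (x : V))).
  rewrite (reindex (cast_ord (esym dV))) /=; last first.
    by apply: onW_bij; exists (cast_ord dV); [apply: cast_ordKV | apply: cast_ordK].
  apply: eq_bigr => j _; set y := coord _ _ _.
  have -> : y *: ((vbasis {: V})`_j : V) = (y : nat)%:R * (vbasis {: V})`_j :> F by [].
  by case: y => [[|[|//]]] ylt; rewrite ?mul0r ?mul1r.
pose M : 'M[F]_r := \matrix_(i, j) b j ^+ (2 ^ i).
have uM : M \in unitmx.
  rewrite -row_free_unit -kermx_eq0; apply/rowV0P => a /sub_kermxP aM.
  pose p : {poly F} := \sum_(i < r) a 0 i *: 'X^(2 ^ i).
  have p0 : p = 0.
    apply/eqP; apply: contraT => pn0.
    have : (size p <= #|F|)%N.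
      apply: leq_trans (size_sum _ _ _) _; apply/bigmax_leqP => i _.
      apply: leq_trans (size_scale_leq _ _) _.
      by rewrite size_polyXn cardF ltn_exp2l.
    rewrite leqNgt => /negP[]; rewrite cardE.
    apply: (max_poly_roots pn0 _ (enum_uniq _)); apply/allP => x _.
    have [c ->] := bP x; rewrite rootE /p horner_sum.
    under eq_bigr => i _ do rewrite hornerZ hornerXn expr_pow2_sum mulr_sumr.
    rewrite exchange_big big1 //= => j _; case: (c j); last first.
      by rewrite big1 // => i _; rewrite expr0n expn_eq0 /= mulr0.
    have := congr1 (fun u : 'rV_r => u 0 j) aM; rewrite !mxE => E.
    by rewrite -[RHS]E; apply: eq_bigr => i _; rewrite mxE.
  apply/rowP => i; rewrite mxE; have := congr1 (coefp (2 ^ i)) p0.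
  rewrite /= coef_sum coef0 (bigD1 i) //= coefZ coefXn eqxx mulr1 big1 ?addr0 //.
  move=> k ki; rewrite coefZ coefXn; case: eqP => [/eqP|]; last by rewrite mulr0.
  by rewrite eqn_exp2l // val_eqE eq_sym (negPf ki).
pose a := (\row_j f (b j)) *m invmx M.
have aM j : f (b j) = \sum_(i < r) a 0 i * b j ^+ (2 ^ i).
  have := congr1 (fun u : 'rV_r => u 0 j) (mulmxKV uM (\row_j f (b j))).
  by rewrite -/a !mxE => <-; apply: eq_bigr => i _; rewrite !mxE.
exists (a 0) => x; have [c ->] := bP x.
rewrite (big_morph f fD f0).
under [RHS]eq_bigr do rewrite expr_pow2_sum mulr_sumr.
rewrite exchange_big; apply: eq_bigr => j _.
case: (c j); first by rewrite mulr1n aM.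
by rewrite mulr0n f0 big1 // => i _; rewrite expr0n expn_eq0 /= mulr0.
Qed.

(* Payne: the permutation x |-> f x / x has vanishing power sums. If i < M were
   the extreme exponents of f, the power sum of exponent 2^m - 1, where
   m = i + (r - M), would be a product of powers of the two extreme coefficients. *)
Lemma additive_o_polynomial (f : F -> F) :
    {morph f : x y / x + y} -> injective (fun x => f x / x) ->
  exists (a : F) (i : nat), forall x, f x = a * x ^+ (2 ^ i).
Proof.
move=> fD h_inj; have [a fE] := additive_linearized fD.
have [i0 ai0|a0] := pickP (fun i => a i != 0); last first.
  have f0 x : f x = 0.
    by rewrite fE big1 // => i _; move/negbFE/eqP: (a0 i) => ->; rewrite mul0r.
  have /eqP : 1 = 0 :> F by apply: h_inj; rewrite /= !f0 !mul0r.
  by rewrite oner_eq0.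
pose i : 'I_r := [arg min_(i < i0 | a i != 0) i].
pose M : 'I_r := [arg max_(i > i0 | a i != 0) i].
have [ai i_min] : a i != 0 /\ forall k, a k != 0 -> (i <= k)%N.
  by rewrite /i; case: arg_minnP.
have [aM M_max] : a M != 0 /\ forall k, a k != 0 -> (k <= M)%N.
  by rewrite /M; case: arg_maxnP.
have [ltiM|leMi] := ltnP i M; last first.
  exists (a i), i => x; rewrite fE (bigD1 i) //= big1 ?addr0 // => k ki.
  have [->|ak] := eqVneq (a k) 0; first by rewrite mul0r.
  case/eqP: ki; apply: val_inj; apply/eqP; rewrite eqn_leq i_min // andbT.
  exact: leq_trans (M_max _ ak) leMi.
(* The binary digits of [k] are [m] ones, so [f x ^+ k] is the product of the [f x ^+ (2 ^ j)] with
   [j < m], each a linearized polynomial again. *)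
exfalso; pose m := (i + (r - M))%N; pose k := (2 ^ m).-1.
have Mr := ltn_ord M.
have m_bounds : (0 < m < r)%N by rewrite /m; lia.
have k_bounds : (0 < k < (2 ^ r).-1)%N.
  have := @ltn_exp2l 2 0 m isT; have := @ltn_exp2l 2 m r isT; rewrite /k; lia.
have kE : k = (\sum_(j < m) 2 ^ j)%N.
  rewrite /k -sum_pow2_iota succnK -(big_mkord xpredT (fun j => 2 ^ j)%N).
  by rewrite /index_iota subn0.
(* As [0^-1 = 0], this holds at 0 too, where it needs [#|F| > 2]. *)
have pow_inv (x : F) : x^-1 = x ^+ (#|F|.-2).
  have [->|x0] := eqVneq x 0.
    by rewrite invr0 expr0n cardF gtn_eqF //; lia.
  apply: (mulfI x0); rewrite divff // -exprS; apply: (mulfI x0).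
  rewrite mulr1 -exprS -[LHS]expf_card; congr (_ ^+ _); rewrite cardF; lia.
(* Here [t] picks one term of [f] in each of the [m] factors. *)
pose E (t : {ffun 'I_m -> 'I_r}) := (\sum_(j < m) 2 ^ (t j + j))%N.
pose A (t : {ffun 'I_m -> 'I_r}) := \prod_(j < m) a (t j) ^+ (2 ^ j).
have fk x : f x ^+ k = \sum_t A t * x ^+ E t.
  rewrite kE expr_sum.
  under eq_bigr => j _ do rewrite fE expr_pow2_sum.
  rewrite bigA_distr_bigA; apply: eq_bigr => t _ /=.
  rewrite /A /E expr_sum -big_split; apply: eq_bigr => j _ /=.
  by rewrite exprMn -exprM -expnD.
have : \sum_x (f x / x) ^+ k = 0.
  have <- : \sum_(x : F) x ^+ k = \sum_x (f x / x) ^+ k by apply: reindex_inj.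
  rewrite sum_exprE; last by lia.
  by case: ifP => // /dvdn_leq; rewrite cardF; lia.
under eq_bigr => x _.
  rewrite exprMn fk pow_inv -exprM mulr_suml.
  under eq_bigr => t _ do rewrite -mulrA -exprD.
  over.
rewrite exchange_big /=.
under eq_bigr => t _.
  rewrite -mulr_sumr sum_exprE; last by rewrite cardF addn_gt0 muln_gt0; lia.
  over.
(* Modulo [2 ^ r - 1] the factor [2 ^ r - 2] is -1. *)
have dvdE t : ((2 ^ r).-1 %| E t + (2 ^ r).-2 * k)%N = (E t == k %[mod (2 ^ r).-1]).
  rewrite -(eqn_modDr ((2 ^ r).-2 * k)) -mulSn prednK; last by lia.
  by rewrite modnMr.
have E_iota (g : nat -> nat) :
    (\sum_(j < m) 2 ^ (g j + j) = \sum_(j <- iota 0 m) 2 ^ (g j + j))%N.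
  by rewrite -(big_mkord xpredT (fun j => 2 ^ (g j + j))%N) /index_iota subn0.
pose t0 := [ffun j : 'I_m => if (j < r - M)%N then i else M].
have Et0 : E t0 = k %[mod (2 ^ r).-1].
  rewrite -[RHS](sum_forced_exponents i Mr) -E_iota; congr (_ %% _)%N.
  by apply: eq_bigr => j _; rewrite ffunE; case: ifP.
(* Any other [t] involves a zero coefficient or violates the congruence by [forced_exponents]. What
   remains is [- A t0], which is nonzero. *)
rewrite (bigD1 t0) //= big1 => [|t tt0]; last first.
  have [/forallP at0|/forallPn[j]] := boolP [forall j, a (t j) != 0]; last first.
    rewrite negbK => /eqP atj; rewrite /A (bigD1 j) //= atj expr0n expn_eq0 /=.
    by rewrite !mul0r.
  rewrite cardF dvdE; case: eqP => [Et|]; last by rewrite mulr0.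
  case/eqP: tt0; apply/ffunP => j; rewrite ffunE; apply: val_inj.
  pose tn j := oapp (fun j : 'I_m => t j : nat) 0%N (insub j).
  have tnE (l : 'I_m) : tn l = t l by rewrite /tn valK.
  rewrite /= -tnE (@forced_exponents r i M tn) ?ltiM ?ltn_ord //.
  - by case: ifP.
  - by move=> l lm; rewrite -[l]/(val (Ordinal lm)) tnE i_min ?M_max.
  - by rewrite -E_iota -Et; congr (_ %% _)%N; apply: eq_bigr => l _; rewrite tnE.
rewrite addr0 cardF dvdE Et0 eqxx mulrN1 => /eqP; rewrite oppr_eq0.
apply/negP/prodf_neq0 => j _; rewrite expf_neq0 // ffunE.
by case: ifP.
Qed.

End Payne.

(** * Arc subgroups of the affine plane *)

Section ArcGroups.

Variables (F : finFieldType) (r : nat).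
Hypothesis cardF : #|F| = (2 ^ r)%N.

Implicit Types (A B u : F * F) (G : {set F * F}).

Definition det2 A B : F := A.1 * B.2 - A.2 * B.1.

(** Boolean, so that [maxset] applies. In characteristic 2 the first two conditions already make [G]
    a subgroup. *)
Definition arc_group G : bool :=
  [&& 0 \in G, [forall A in G, forall B in G, A + B \in G]
    & [forall A in G, forall B in G,
         (det2 A B == 0) ==> [|| A == 0, B == 0 | A == B]]].

Lemma arc_groupP G :
  reflect [/\ 0 \in G, {in G &, forall A B, A + B \in G}
            & {in G &, forall A B, det2 A B = 0 -> [\/ A = 0, B = 0 | A = B]}]
          (arc_group G).
Proof.
apply: (iffP and3P) => -[G0 GD Gdet]; split=> //.
- by move=> A B AG BG; move/forall_inP/(_ A AG)/forall_inP/(_ B BG): GD.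
- move=> A B AG BG /eqP dAB.
  move/forall_inP/(_ A AG)/forall_inP/(_ B BG)/implyP/(_ dAB): Gdet.
  by case/or3P=> /eqP; [constructor 1|constructor 2|constructor 3].
- by apply/forall_inP => A AG; apply/forall_inP => B BG; apply: GD.
- apply/forall_inP => A AG; apply/forall_inP => B BG; apply/implyP => /eqP dAB.
  by apply/or3P; have [->|->|->] := Gdet A B AG BG dAB;
    [constructor 1|constructor 2|constructor 3].
Qed.

(** In characteristic 2 the equation puts [u] on the secant through [B] and [A + B]. *)
Definition covered G u : bool :=
  [exists A in G, (A != 0) && [exists B in G, det2 (u + B) A == 0]].

Lemma coveredP G u :
  reflect (exists A B, [/\ A \in G, A != 0, B \in G & det2 (u + B) A = 0])
          (covered G u).
Proof.
apply: (iffP exists_inP) => [[A AG /andP[A0 /exists_inP[B BG /eqP]]]|].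
  by exists A, B.
move=> [A [B [AG A0 BG /eqP dAB]]]; exists A => //; rewrite A0.
by apply/exists_inP; exists B.
Qed.

Lemma addAA A : A + A = 0.
Proof. by apply/pair_eqP; rewrite /= !(addrr_pchar2 (char2 cardF)) !eqxx. Qed.

Lemma oppA A : - A = A.
Proof. by apply/eqP; rewrite eq_sym -addr_eq0 addAA. Qed.

Lemma addAK A B : A + B + B = A.
Proof. by rewrite -addrA addAA addr0. Qed.

Definition adjoin G u : {set F * F} := [set X | (X \in G) || (X + u \in G)].

Lemma sub_adjoin G u : G \subset adjoin G u.
Proof. by apply/subsetP=> X XG; rewrite inE XG. Qed.

Lemma adjoin_self G u : 0 \in G -> u \in adjoin G u.
Proof. by rewrite inE addAA => ->; rewrite orbT. Qed.

Lemma card_adjoin G u : (#|adjoin G u| <= 2 * #|G|)%N.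
Proof.
have -> : adjoin G u = G :|: ((fun X : F * F => X + u) @: G).
  apply/setP=> X; rewrite !inE; congr (_ || _); apply/idP/imsetP => [XG|].
    by exists (X + u); rewrite ?addAK.
  by case=> Y YG ->; rewrite addAK.
by rewrite mul2n -addnn (leq_trans (leq_card_setU _ _)) // leq_add2l leq_imset_card.
Qed.

(** Up to sign, a determinant involving the coset [G + u] is some [det2 (u + B) A] with [A] and [B]
    in [G]: if both elements lie in the coset, one is replaced by their sum. If it vanished with [A]
    nonzero, [u] would be covered. *)
Lemma arc_group_adjoin G u : arc_group G -> ~~ covered G u ->
  arc_group (adjoin G u).
Proof.
case/arc_groupP=> G0 GD Gdet nu.
have free A B : A \in G -> B \in G -> det2 (u + B) A = 0 -> A = 0.
  move=> AG BG d0; apply/eqP; apply: contraNT nu => A0.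
  by apply/coveredP; exists A, B.
apply/arc_groupP; split; first by rewrite inE G0.
  move=> A B; rewrite !inE => /orP[AG|AG] /orP[BG|BG]; apply/orP.
  - by left; apply: GD.
  - by right; rewrite -addrA; apply: GD.
  - by right; rewrite addrAC; apply: GD.
  - by left; rewrite -[A](addAK _ u) -addrA [u + B]addrC; apply: GD.
move=> A B; rewrite !inE => /orP[AG|AG] /orP[BG|BG] dAB.
- exact: Gdet.
- constructor 1; apply: (free A (B + u)) => //.
  rewrite addrC addAK; rewrite /det2 in dAB *; apply/eqP.
  by rewrite -oppr_eq0 -dAB; apply/eqP; ring.
- constructor 2; apply: (free B (A + u)) => //.
  by rewrite addrC addAK.
- constructor 3; apply/eqP; rewrite -[B]oppA -addr_eq0; apply/eqP.
  apply: (free _ (A + u)) => //.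
    by rewrite -[A](addAK _ u) -addrA [u + B]addrC; apply: GD.
  rewrite addrC addAK -dAB /det2 /=; ring.
Qed.

(** An uncovered [u] could be adjoined, so it lies in [G] by maximality; but then it is covered,
    taking [B = u]. *)
Lemma maximal_covers G A u :
  maxset arc_group G -> A \in G -> A != 0 -> covered G u.
Proof.
case/maxsetP=> aG maxG AG A0; have [G0 GD _] := arc_groupP _ aG.
apply: contraT => nu.
have uG : u \in G.
  by rewrite -(maxG _ (arc_group_adjoin aG nu) (sub_adjoin G u)) adjoin_self.
case/negP: nu; apply/coveredP; exists A, u; split=> //.
by rewrite addAA /det2 !mul0r subrr.
Qed.

Lemma card_arc_group_dvd G : arc_group G -> (#|G| %| 2 ^ (r + r))%N.
Proof.
case/arc_groupP=> G0 GD _.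
have gG : group_set (G : {set (F * F)%type}).
  by apply/group_setP; split.
by have := cardSg (subsetT (Group gG)); rewrite cardsT card_prod cardF expnD.
Qed.

(* A covered point x lies on the secant through B and A + B, so is counted at
   least twice when A and B vary; each pair accounts for at most two points. *)
Lemma card_parabola_covered G : arc_group G ->
  (#|[set x : F | covered G (x, x ^+ 2)]| <= #|G|.-1 * #|G|)%N.
Proof.
case/arc_groupP=> G0 GD _.
pose G' := G :\ (0 : F * F).
pose hit (x : F) A B : nat := det2 ((x, x ^+ 2) + B) A == 0.
have few A B : A != 0 -> (\sum_x hit x A B <= 2)%N.
  (* The determinant as a polynomial in [x]; its nonconstant coefficients are, up to sign, the
     coordinates of [A]. *)
  move=> A0; pose p : {poly F} := (B.1 * A.2 - B.2 * A.1)%:P + A.2 *: 'X - A.1 *: 'X^2.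
  have p0 : p != 0.
    apply: contraNneq A0 => p0; apply/eqP/pair_eqP => /=.
    have := congr1 (coefp 1) p0; have := congr1 (coefp 2) p0.
    rewrite /p /= !(coefD, coefN, coefZ, coefC, coefX, coefXn) /=.
    rewrite !(mulr0, mulr1, addr0, add0r, oppr0) => /eqP.
    by rewrite oppr_eq0 => -> ->; rewrite eqxx.
  have sz_p : (size p <= 3)%N.
    by apply/leq_sizeP => -[|[|[|j]]] // _;
      rewrite /p !(coefD, coefN, coefZ, coefC, coefX, coefXn) /= !(mulr0, addr0, oppr0).
  rewrite /hit (eq_bigr (fun x : F =>
    if det2 ((x, x ^+ 2) + B) A == 0 then 1%N else 0%N)); last first.
    by move=> x _; case: eqP.
  rewrite -big_mkcond sum1dep_card cardE -ltnS (leq_trans _ sz_p) //.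
  apply: max_poly_roots => //; rewrite ?enum_uniq //; apply/allP => x.
  rewrite mem_enum inE rootE /p => /eqP <-; rewrite !hornerE /det2 /=; apply/eqP.
  ring.
have many x : covered G (x, x ^+ 2) ->
    (2 <= \sum_(A in G') \sum_(B in G) hit x A B)%N.
  case/coveredP=> A [B [AG A0 BG dAB]].
  have dBA : det2 ((x, x ^+ 2) + (B + A)) A = 0 by rewrite -dAB /det2 /=; ring.
  rewrite (bigD1 A) ?inE ?A0 //= (bigD1 B) //= (bigD1 (B + A)) /=.
    by rewrite /hit dAB dBA eqxx.
  by rewrite GD //= -subr_eq0 addrAC subrr add0r.
rewrite -(leq_pmul2r (isT : 0 < 2)%N) -sum_nat_const.
apply: (@leq_trans (\sum_x \sum_(A in G') \sum_(B in G) hit x A B)%N).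
  rewrite big_mkcond; apply: leq_sum => x _; rewrite inE; case: ifP => // /many.
  by [].
rewrite exchange_big; under eq_bigr do rewrite exchange_big.
apply: (@leq_trans (\sum_(A in G') \sum_(B in G) 2)%N).
  apply: leq_sum => A; rewrite !inE => /andP[A0 _].
  by apply: leq_sum => B _; apply: few.
by rewrite !sum_nat_const mulnA (cardsD1 (0 : F * F) G) G0.
Qed.

(* The slope of the line through 0 and A; None is the vertical direction. *)
Definition slope A : option F := if A.1 == 0 then None else Some (A.2 / A.1).

(** The linear form whose kernel is the direction [d]. *)
Definition slope_form (d : option F) A : F :=
  if d is Some s then A.2 - s * A.1 else A.1.

Lemma slope_form_eq0 d A : A != 0 -> slope_form d A = 0 -> slope A = d.
Proof.
case: A d => x y [s|] A0 /= /eqP; rewrite /slope /=; last first.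
  by move=> /eqP->; rewrite eqxx.
rewrite subr_eq0 => /eqP ys; case: eqP => [x0|/eqP x0]; last by rewrite ys mulfK.
by case/eqP: A0; rewrite ys x0 mulr0.
Qed.

Lemma slope_det A B : slope A = slope B -> det2 A B = 0.
Proof.
rewrite /slope /det2; case: eqP => [->|/eqP A1]; case: eqP => [->|/eqP B1] //.
  by rewrite mul0r mulr0 subrr.
by case=> E; rewrite -[A.2](divfK A1) E mulrAC divfK // mulrC subrr.
Qed.

Lemma slope_formD d A B : slope_form d (A + B) = slope_form d A + slope_form d B.
Proof. by case: d => [s|] //=; ring. Qed.

Lemma slope_form_coord d x y :
  slope_form d (x, y) = x * slope_form d (1, 0) + y * slope_form d (0, 1).
Proof. by case: d => [s|] /=; ring. Qed.

(** The forms of two distinct directions are coordinates on the plane, in which the determinant is a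
    nonzero multiple of [det2]. *)
Lemma slope_form_det d d' A B : d != d' ->
  slope_form d' A * slope_form d B = slope_form d' B * slope_form d A ->
  det2 A B = 0.
Proof.
move=> dd' /eqP; rewrite -subr_eq0 => /eqP.
case: d d' dd' => [s|] [s'|] //= dd' E; rewrite /det2.
- have ss' : s - s' != 0 by rewrite subr_eq0.
  by apply: (mulfI ss'); rewrite mulr0 -E; ring.
- by rewrite -E; ring.
- by rewrite -[RHS]oppr0 -E; ring.
Qed.

(** A nonzero fixed [x] gives [f x / x = a], as does 1. *)
Lemma o_polynomial_fixed (f : F -> F) (a : F) i (x : F) :
  injective (fun x : F => f x / x) -> (forall x, f x = a * x ^+ (2 ^ i)) ->
  x ^+ (2 ^ i) = x -> x = 0 \/ x = 1.
Proof.
move=> f_inj fE xi; have [->|x0] := eqVneq x 0; [by left | right].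
by apply: f_inj; rewrite /= !fE xi expr1n mulr1 divr1 mulfK.
Qed.

(* A subgroup of order #|F| misses two directions; its two projections along
   them are bijective, and it is the graph of an additive o-polynomial over the
   corresponding basis. *)
Lemma card_arc_group_lt G w v :
    arc_group G -> (1, 0) \in G -> (0, 1) \in G ->
    (w, w ^+ 2) \in G -> (v, v ^+ 2) \in G ->
    w != 0 -> w != 1 -> v != 0 -> v != 1 -> v != w -> v != w + 1 ->
  (2 < #|F|)%N -> (#|G| < #|F|)%N.
Proof.
move=> aG e1G e2G wG vG w0 w1 v0 v1 vw vw1 q2.
have [G0 GD Gdet] := arc_groupP _ aG.
pose G' := G :\ (0 : F * F); pose D := slope @: G'.
have cG : #|G| = #|G'|.+1 by rewrite (cardsD1 (0 : F * F) G) G0.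
have cD : #|D| = #|G'|.
  apply: card_in_imset => A B; rewrite !inE => /andP[A0 AG] /andP[B0 BG].
  move=> /slope_det /(Gdet A B AG BG) [E|E|//].
    by rewrite E eqxx in A0.
  by rewrite E eqxx in B0.
have cDC : (#|D| + #|~: D| = #|F|.+1)%N by rewrite cardsC card_option.
(* Distinct slopes give [#|G| <= #|F| + 2], whereas a power of two above [#|F|] is at least
   [2 * #|F|]. *)
have leGq : (#|G| <= #|F|)%N.
  have /(dvdn_pfactor _ _ (isT : prime 2))[k _ Gk] := card_arc_group_dvd aG.
  rewrite Gk cardF leq_exp2l // leqNgt; apply/negP => rk.
  have leG : (#|G| <= #|F|.+2)%N by rewrite cG -cD ltnS -cDC leq_addr.
  have : (2 ^ r.+1 <= #|F|.+2)%N by rewrite (leq_trans _ leG) // Gk leq_exp2l.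
  by rewrite expnS -cardF mul2n -addnn -addn2 leq_add2l leqNgt q2.
rewrite ltn_neqAle leGq andbT; apply/eqP => Gq.
have /cards2P[d [d' [dd' DC]]] : #|~: D| == 2%N.
  by rewrite -(eqn_add2l #|D|) cDC -Gq cG -cD addn2.
have form0 c A : c \in ~: D -> A \in G -> slope_form c A = 0 -> A = 0.
  rewrite inE => cND AG cA; apply/eqP; apply: contraNT cND => A0.
  by rewrite -(slope_form_eq0 A0 cA) imset_f // !inE A0.
have form_inj c : c \in ~: D -> {in G &, injective (slope_form c)}.
  move=> cD' A B AG BG E; apply/eqP; rewrite -[B]oppA -addr_eq0; apply/eqP.
  apply: (form0 c) => //; first exact: GD.
  by rewrite slope_formD E (addrr_pchar2 (char2 cardF)).
have dD : d \in ~: D by rewrite DC !inE eqxx.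
have d'D : d' \in ~: D by rewrite DC !inE eqxx orbT.
(* [g x] is the element of [G] with [d]-coordinate [x]; reading off its [d']-coordinate makes [G]
   the graph of [f]. *)
have /fin_all_exists[g gP] : forall x, exists A, (A \in G) && (slope_form d A == x).
  have imG : slope_form d @: G = setT.
    apply/eqP; rewrite eqEcard subsetT cardsT card_in_imset ?Gq ?leqnn //.
    exact: form_inj.
  move=> x; have : x \in slope_form d @: G by rewrite imG inE.
  by case/imsetP=> A AG ->; exists A; rewrite AG eqxx.
have gG x : g x \in G by case/andP: (gP x).
have formg x : slope_form d (g x) = x by case/andP: (gP x) => _ /eqP.
have gform A : A \in G -> g (slope_form d A) = A.
  by move=> AG; apply: (form_inj d) => //.
pose f x := slope_form d' (g x).
have fD : {morph f : x y / x + y}.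
  move=> x y; rewrite /f -slope_formD; congr slope_form.
  by apply: (form_inj d); rewrite ?GD // slope_formD !formg.
(* Since [0 / 0 = 0], injectivity requires the quotient to be nonzero away from 0, which holds
   because [G] misses the direction [d']. *)
have f_eq0 x : f x / x = 0 -> x = 0.
  move/eqP; rewrite mulf_eq0 invr_eq0 => /orP[|/eqP//] /eqP /(form0 _ _ d'D (gG x)) gx0.
  by rewrite -(formg x) gx0; case: (d) => [s|] //=; rewrite mulr0 subrr.
have f_inj : injective (fun x => f x / x).
  move=> x y /= E.
  have [x0|x0] := eqVneq x 0.
    by rewrite x0; apply/esym/f_eq0; rewrite -E x0 invr0 mulr0.
  have [y0|y0] := eqVneq y 0.
    by rewrite y0; apply/f_eq0; rewrite E y0 invr0 mulr0.
  have {}E : f x * y = f y * x.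
    by rewrite -[f x](divfK x0) E mulrAC divfK // mulrC.
  rewrite -(formg x) -(formg y).
  have := Gdet _ _ (gG x) (gG y); case.
  - by apply: (slope_form_det dd'); rewrite !formg.
  - move=> gx; move: x0; rewrite -(formg x) gx.
    by case: (d) => [s|] /=; rewrite ?mulr0 ?subrr eqxx.
  - move=> gy; move: y0; rewrite -(formg y) gy.
    by case: (d) => [s|] /=; rewrite ?mulr0 ?subrr eqxx.
  - by move->.
have [a [i fE]] := additive_o_polynomial cardF fD f_inj.
have graph A : A \in G -> slope_form d' A = a * slope_form d A ^+ (2 ^ i).
  by move=> AG; rewrite -fE /f gform.
pose p := slope_form d (1, 0); pose p' := slope_form d (0, 1).
(* With [Q = 2 ^ i], [graph] at [(x, x^2)], [(1, 0)] and [(0, 1)] yields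
   [p^Q (x + x^Q) = p'^Q (x + x^Q)^2], and [x + x^Q] is nonzero. Comparing [w] and [v] then shows
   that [v + w] is fixed by the [Q]-th power. *)
have on_parabola x : (x, x ^+ 2) \in G -> x != 0 -> x != 1 ->
    p ^+ (2 ^ i) = p' ^+ (2 ^ i) * (x + x ^+ (2 ^ i)).
  move=> /graph; rewrite !(slope_form_coord _ x) -/p -/p' !graph // -/p -/p' => E x0 x1.
  have a0 : a != 0.
    apply: contra_neq (oner_neq0 F) => a0; apply: f_eq0.
    by rewrite fE a0 !mul0r.
  have xX : x - x ^+ (2 ^ i) != 0.
    rewrite subr_eq0 eq_sym; apply/eqP => /(o_polynomial_fixed f_inj fE).
    by case=> x01; [case/eqP: x0 | case/eqP: x1].
  apply: (mulfI xX); rewrite -[p' ^+ _](oppr_pchar2 (char2 cardF)).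
  apply: (mulfI a0); apply/eqP; rewrite -subr_eq0; apply/eqP.
  move: E; rewrite (expr_pow2D cardF) /= !exprMn => /eqP.
  by rewrite -subr_eq0 => /eqP <-; ring.
have P'0 : p' ^+ (2 ^ i) != 0.
  apply: expf_neq0; apply/eqP => /(form0 _ _ dD e2G) /(congr1 snd) /eqP.
  by rewrite oner_eq0.
have /(mulfI P'0) wv := etrans (esym (on_parabola w wG w0 w1)) (on_parabola v vG v0 v1).
have vwD : v + w = v ^+ (2 ^ i) + w ^+ (2 ^ i).
  apply/eqP; rewrite -subr_eq0 opprD addrACA !(oppr_pchar2 (char2 cardF)) -wv.
  by rewrite (addrr_pchar2 (char2 cardF)).
have : (v + w) ^+ (2 ^ i) = v + w by rewrite (expr_pow2D cardF) -vwD.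
case/(o_polynomial_fixed f_inj fE) => /eqP.
  by rewrite addr_eq0 (oppr_pchar2 (char2 cardF)) (negPf vw).
move/eqP=> E; case/eqP: vw1.
by rewrite -E addrCA (addrr_pchar2 (char2 cardF)) addr0.
Qed.

(** * A starting group through prescribed points of the parabola *)

Lemma arc_group0 : arc_group [set (0 : F * F)].
Proof.
apply/arc_groupP; split; first by rewrite inE.
  by move=> A B /set1P-> /set1P->; rewrite inE addr0.
by move=> A B /set1P-> _ _; constructor 1.
Qed.

(** The points [(1, 0)], [(0, 1)], [(w, w^2)], [(v, v^2)] are adjoined in turn, each uncovered by
    the previous group. For the third, [w ^+ 4 != w] keeps [w] out of the field of order 4. For the
    fourth, a group of order at most 8 covers at most [7 * 8 = 56] points of the parabola. *)
Lemma exists_small_arc_group (w : F) : (56 < #|F|)%N -> w ^+ 4 != w ->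
  exists (G : {set F * F}) (v : F),
    [/\ arc_group G, (1, 0) \in G, (0, 1) \in G, (w, w ^+ 2) \in G &
      [/\ (v, v ^+ 2) \in G, v != 0, v != 1, v != w & v != w + 1]].
Proof.
move=> q56 w4.
have w0 : w != 0 by apply: contraNneq w4 => ->; rewrite expr0n.
have w1 : w != 1 by apply: contraNneq w4 => ->; rewrite expr1n.
have c2 : 1 + 1 = 0 :> F := addrr_pchar2 (char2 cardF) 1.
have w_nat (b : bool) : w + b%:R != 0.
  by rewrite addr_eq0 (oppr_pchar2 (char2 cardF)); case: b.
have w2_nat (b : bool) : w ^+ 2 + b%:R != 0.
  have -> : b%:R = b%:R ^+ 2 :> F by case: b; rewrite ?expr1n ?expr0n.
  by rewrite -(expr_pow2D cardF 1) expf_neq0.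
have w2w_nat (b : bool) : w ^+ 2 + w != b%:R.
  case: b; last by rewrite expr2 -[X in _ + X]mulr1 -mulrDr mulf_neq0 // (w_nat true).
  apply: contraNneq w4 => w2; rewrite -subr_eq0.
  have -> : w ^+ 4 - w = w * (w - 1) * (w ^+ 2 + w + 1) by ring.
  by rewrite w2 c2 mulr0.
pose G1 := adjoin [set (0 : F * F)] (1, 0); pose G2 := adjoin G1 (0, 1).
have aG1 : arc_group G1.
  apply: (arc_group_adjoin arc_group0); apply/coveredP=> -[A [B [/set1P-> ]]].
  by rewrite eqxx.
have G1P A : A \in G1 -> A = 0 \/ A = (1, 0).
  rewrite !inE => /orP[/eqP->|]; [by left | right].
  by apply/eqP; rewrite -[(1, 0)]oppA -addr_eq0.
have aG2 : arc_group G2.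
  apply: (arc_group_adjoin aG1); apply/coveredP=> -[A [B [/G1P AG A0 /G1P BG]]].
  case: AG A0 => -> A0; first by rewrite eqxx in A0.
  case: BG => ->; rewrite /det2 /= !(addr0, add0r, mulr0, mulr1, sub0r) => /eqP.
    by rewrite oppr_eq0 oner_eq0.
  by rewrite oppr_eq0 oner_eq0.
have G2P A : A \in G2 -> exists b c : bool, A = (b%:R, c%:R).
  rewrite inE => /orP[/G1P[]->|/G1P[]].
  - by exists false, false.
  - by exists true, false.
  - move/eqP; rewrite addr_eq0 oppA => /eqP ->; by exists false, true.
  - move=> E; exists true, true; rewrite -[A](addAK _ (0, 1)) E.
    by apply/pair_eqP; rewrite /= addr0 add0r !eqxx.
pose G3 := adjoin G2 (w, w ^+ 2).
have aG3 : arc_group G3.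
  apply: (arc_group_adjoin aG2).
  apply/coveredP=> -[A [B [/G2P[b [c ->]] A0 /G2P[b' [c' ->]]]]].
  rewrite /det2 /=; case: b A0; case: c => A0;
    rewrite !(mulr0, mulr1, subr0, sub0r, oppr0).
  - move/eqP; rewrite subr_eq0 => /eqP E; have /eqP[] := w2w_nat (b' (+) c').
    have -> : (b' (+) c')%:R = b'%:R + c'%:R :> F.
      by case: (b'); case: (c'); rewrite ?c2 ?addr0 ?add0r.
    apply/eqP; rewrite -subr_eq0.
    have -> : w ^+ 2 + w - (b'%:R + c'%:R) =
      (w ^+ 2 + c'%:R - (w + b'%:R)) + (1 + 1) * (w - c'%:R) by ring.
    by rewrite E subrr c2 mul0r addr0.
  - by move/eqP; rewrite oppr_eq0 (negPf (w2_nat _)).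
  - by move/eqP; rewrite (negPf (w_nat _)).
  - by case/eqP: A0.
have cG3 : (#|G3| <= 8)%N.
  apply: leq_trans (card_adjoin _ _) _; rewrite (leq_mul2l 2 _ 4).
  apply: leq_trans (card_adjoin _ _) _; rewrite (leq_mul2l 2 _ 2).
  by apply: leq_trans (card_adjoin _ _) _; rewrite cards1.
have [v nv] : exists v, ~~ covered G3 (v, v ^+ 2).
  apply/existsP; rewrite -negb_forall; apply: contraL q56 => /forallP cov.
  rewrite -leqNgt -cardsT.
  have -> : [set: F] = [set x | covered G3 (x, x ^+ 2)].
    by apply/setP=> x; rewrite !inE cov.
  apply: leq_trans (card_parabola_covered aG3) _.
  by rewrite (@leq_mul _ _ 7 8) // -subn1 leq_subLR.
pose G4 := adjoin G3 (v, v ^+ 2); exists G4, v.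
have aG4 : arc_group G4 := arc_group_adjoin aG3 nv.
have [G30 G3D _] := arc_groupP _ aG3.
have [G20 _ _] := arc_groupP _ aG2.
have [G10 _ _] := arc_groupP _ aG1.
have e1G1 : (1, 0) \in G1 by rewrite adjoin_self ?inE.
have e1G2 : (1, 0) \in G2 := subsetP (sub_adjoin _ _) _ e1G1.
have e1G3 : (1, 0) \in G3 := subsetP (sub_adjoin _ _) _ e1G2.
have e2G2 : (0, 1) \in G2 by apply: adjoin_self.
have e2G3 : (0, 1) \in G3 := subsetP (sub_adjoin _ _) _ e2G2.
have wG3 : (w, w ^+ 2) \in G3 by apply: adjoin_self.
(* Points of [G3] are covered. As [G3] contains the parabola points over 0, 1, [w] and [w + 1], this
   separates [v] from all four. *)
have vG3 : (v, v ^+ 2) \notin G3.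
  apply: contra nv => vG3; apply/coveredP; exists (1, 0), (v, v ^+ 2); split=> //.
    by apply/eqP => /(congr1 fst) /eqP; rewrite oner_eq0.
  by rewrite addAA /det2 !mul0r subrr.
have sG := subsetP (sub_adjoin G3 (v, v ^+ 2)).
split; [by [] | exact: sG | exact: sG | exact: sG | split; first exact: adjoin_self].
- by apply: contraNneq vG3 => ->; rewrite expr0n.
- apply: contraNneq vG3 => ->; rewrite expr1n.
  have -> : (1, 1) = (1, 0) + (0, 1) :> F * F.
    by apply/pair_eqP; rewrite /= addr0 add0r !eqxx.
  exact: G3D.
- by apply: contraNneq vG3 => ->.
- apply: contraNneq vG3 => ->; rewrite (expr_pow2D cardF 1) expr1n.
  have -> : (w + 1, w ^+ 2 + 1) = (w, w ^+ 2) + ((1, 0) + (0, 1)) :> F * F.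
    by apply/pair_eqP; rewrite /= addr0 add0r !eqxx.
  by rewrite !G3D.
Qed.

End ArcGroups.

(** * Coordinates in the projective plane *)

Section PlaneGeometry.

Variable F : finFieldType.

Implicit Types (u v w : 'rV[F]_3) (P Q R : point F) (A B C : F * F).

Lemma row3_eta v : v = row3 (v 0 0) (v 0 1) (v 0 2).
Proof.
by apply/rowP => -[[|[|[|//]]] i3]; rewrite !mxE /=; congr (v _ _); apply: val_inj.
Qed.

Lemma row3_eq0 (x y z : F) : (row3 x y z == 0) = [&& x == 0, y == 0 & z == 0].
Proof.
apply/eqP/and3P => [/rowP E|[/eqP-> /eqP-> /eqP->]].
  by have := (E 0, E 1, E 2); rewrite !mxE /= => -[[-> ->] ->]; rewrite eqxx.
by apply/rowP => -[[|[|[|//]]] i3]; rewrite !mxE.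
Qed.

Lemma scale_row3 (c x y z : F) : c *: row3 x y z = row3 (c * x) (c * y) (c * z).
Proof. by apply/rowP => -[[|[|[|//]]] i3]; rewrite !mxE. Qed.

Lemma row3_proportional (a1 a2 a3 b1 b2 b3 : F) :
    a1 * b2 = a2 * b1 -> a1 * b3 = a3 * b1 -> a2 * b3 = a3 * b2 ->
    row3 b1 b2 b3 != 0 ->
  exists c, row3 a1 a2 a3 = c *: row3 b1 b2 b3.
Proof.
move=> E12 E13 E23; rewrite row3_eq0 !negb_and => /or3P[] b0.
- exists (a1 / b1); rewrite scale_row3 divfK //; congr row3.
    by rewrite mulrAC E12 mulfK.
  by rewrite mulrAC E13 mulfK.
- exists (a2 / b2); rewrite scale_row3 divfK //; congr row3.
    by rewrite mulrAC -E12 mulfK.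
  by rewrite mulrAC E23 mulfK.
- exists (a3 / b3); rewrite scale_row3 divfK //; congr row3.
    by rewrite mulrAC -E13 mulfK.
  by rewrite mulrAC -E23 mulfK.
Qed.

(** [n] is the cross product of [v] and [w], and [u x (v x w) = (u.w) v - (u.v) w] vanishes. *)
Lemma orthogonal_cross (u1 u2 u3 v1 v2 v3 w1 w2 w3 : F)
    (n := row3 (v2 * w3 - v3 * w2) (v3 * w1 - v1 * w3) (v1 * w2 - v2 * w1)) :
    u1 * v1 + u2 * v2 + u3 * v3 = 0 -> u1 * w1 + u2 * w2 + u3 * w3 = 0 ->
  n != 0 -> exists c, row3 u1 u2 u3 = c *: n.
Proof.
move=> uv uw; have uv0 x : x * (u1 * v1 + u2 * v2 + u3 * v3) = 0 by rewrite uv mulr0.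
have uw0 x : x * (u1 * w1 + u2 * w2 + u3 * w3) = 0 by rewrite uw mulr0.
apply: row3_proportional; apply/eqP; rewrite -subr_eq0.
- by rewrite -[X in _ == X](subrr 0) -{1}(uw0 v3) -(uv0 w3); apply/eqP; ring.
- by rewrite -[X in _ == X](subrr 0) -{1}(uv0 w2) -(uw0 v2); apply/eqP; ring.
- by rewrite -[X in _ == X](subrr 0) -{1}(uw0 v1) -(uv0 w1); apply/eqP; ring.
Qed.

Lemma coord_class_is_point v : v != 0 -> is_point (coord_class v).
Proof. by move=> v0; apply/existsP; exists v; rewrite v0 eqxx. Qed.

Lemma origin_neq0 : row3 0 0 1 != 0 :> 'rV[F]_3.
Proof. by rewrite row3_eq0 oner_eq0 !andbF. Qed.

(* A junk value, the origin, at v = 0. *)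
Definition pt v : point F :=
  insubd (Point (coord_class_is_point origin_neq0)) (coord_class v).

Lemma coords_pt v : v != 0 -> coords (pt v) = coord_class v.
Proof. by move=> v0; apply: insubdK; apply: coord_class_is_point. Qed.

Lemma pt_surj P : exists2 v, v != 0 & P = pt v.
Proof.
have /existsP[v /andP[v0 /eqP Pv]] := coordsP P; exists v => //.
by apply: val_inj; rewrite /= coords_pt.
Qed.

Lemma ptZ c v : c != 0 -> v != 0 -> pt (c *: v) = pt v.
Proof.
move=> c0 v0; apply: val_inj; rewrite /= !coords_pt ?scaler_eq0 ?negb_or ?c0 //.
apply/setP=> x; apply/imsetP/imsetP=> -[d]; rewrite inE => d0 ->.
  by exists (d * c); rewrite ?inE ?mulf_neq0 // scalerA.
by exists (d / c); rewrite ?inE ?mulf_neq0 ?invr_eq0 // scalerA divfK.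
Qed.

Definition dot u v : F := \sum_(j < 3) u 0 j * v 0 j.

Lemma dot_row3 (a b c x y z : F) :
  dot (row3 a b c) (row3 x y z) = a * x + b * y + c * z.
Proof. by rewrite /dot !big_ord_recl big_ord0 !mxE /= addr0 addrA. Qed.

Lemma dotC u v : dot u v = dot v u.
Proof. by apply: eq_bigr => j _; rewrite mulrC. Qed.

Lemma dotZr c u v : dot u (c *: v) = c * dot u v.
Proof. by rewrite /dot mulr_sumr; apply: eq_bigr => j _; rewrite mxE mulrCA. Qed.

Lemma pt_in_line u v : v != 0 -> (pt v \in line u) = (dot u v == 0).
Proof.
move=> v0; rewrite inE coords_pt //; apply/forall_inP/eqP => [|uv x].
  by move=> uv; apply/eqP/uv/imsetP; exists 1; rewrite ?inE ?oner_eq0 ?scale1r.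
by case/imsetP=> c _ ->; rewrite -[X in X == 0]/(dot u _) dotZr uv mulr0.
Qed.

Lemma line_in_lines u : u != 0 -> line u \in lines F.
Proof. by move=> u0; apply/imsetP; exists u; rewrite ?inE. Qed.

Lemma lineZ c u : c != 0 -> line (c *: u) = line u.
Proof.
move=> c0; apply/setP=> P; have [v v0 ->] := pt_surj P; rewrite !pt_in_line //.
by rewrite dotC dotZr mulf_eq0 (negPf c0) dotC.
Qed.

(** The coefficients of a line through both points form a multiple of the cross product of their
    coordinate vectors. *)
Lemma line_unique P Q l m : l \in lines F -> m \in lines F -> P != Q ->
  P \in l -> Q \in l -> P \in m -> Q \in m -> l = m.
Proof.
move=> lL mL; have [v v0 ->] := pt_surj P; have [w w0 ->] := pt_surj Q => PQ.
pose n := row3 (v 0 1 * w 0 2 - v 0 2 * w 0 1) (v 0 2 * w 0 0 - v 0 0 * w 0 2)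
               (v 0 0 * w 0 1 - v 0 1 * w 0 0).
have n0 : n != 0.
  apply: contraNneq PQ => /eqP; rewrite row3_eq0 !subr_eq0.
  case/and3P=> /eqP E1 /eqP E2 /eqP E3; rewrite (row3_eta w) in w0 *.
  have [c vE] : exists c, v = c *: row3 (w 0 0) (w 0 1) (w 0 2).
    by rewrite {1}(row3_eta v); apply: row3_proportional.
  rewrite vE ptZ //; apply: contraNneq v0 => c0.
  by rewrite vE c0 scale0r.
suff line_n k : k \in lines F -> pt v \in k -> pt w \in k -> k = line n.
  by move=> vl wl vm wm; rewrite (line_n l) // (line_n m).
case/imsetP=> u; rewrite inE => u0 ->; rewrite !pt_in_line // => /eqP uv /eqP uw.
move: uv uw; rewrite [in dot u v](row3_eta u) [in dot u w](row3_eta u).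
rewrite [in dot _ v](row3_eta v) [in dot _ w](row3_eta w) !dot_row3.
move=> uv uw; have [c nE] := orthogonal_cross uv uw n0.
rewrite (row3_eta u) nE lineZ //; apply: contraNneq u0 => c0.
by rewrite (row3_eta u) nE c0 scale0r.
Qed.

Definition aff A : point F := pt (row3 A.1 A.2 1).

Lemma aff_neq0 A : row3 A.1 A.2 1 != 0.
Proof. by rewrite row3_eq0 oner_eq0 !andbF. Qed.

Lemma aff_in_line (a b c : F) A :
  (aff A \in line (row3 a b c)) = (a * A.1 + b * A.2 + c == 0).
Proof. by rewrite pt_in_line ?aff_neq0 // dot_row3 mulr1. Qed.

Lemma aff_inj : injective aff.
Proof.
move=> A B AB; apply/pair_eqP => /=.
have := aff_in_line 1 0 (- A.1) B; have := aff_in_line 0 1 (- A.2) B.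
rewrite -AB !aff_in_line !(mul1r, mul0r, addr0, add0r) !subrr eqxx.
by rewrite !subr_eq0 eq_sym => <-; rewrite eq_sym => <-.
Qed.

Lemma aff_finite A : aff A \notin line_infty F.
Proof. by rewrite aff_in_line !mul0r !add0r oner_eq0. Qed.

Lemma aff_surj P : P \notin line_infty F -> exists A, P = aff A.
Proof.
have [v v0 ->] := pt_surj P; rewrite pt_in_line // (row3_eta v) dot_row3.
rewrite !mul0r !add0r mul1r => v3; exists (v 0 0 / v 0 2, v 0 1 / v 0 2).
rewrite /aff /= -[in RHS](ptZ v3) ?(aff_neq0 (_, _)) //.
by rewrite scale_row3 mulr1 ![v 0 2 * _]mulrC !divfK.
Qed.

Lemma phi_aff A B : phi A (aff B) = aff (B + A).
Proof.
apply: val_inj; rewrite /= !coords_pt ?aff_neq0 // /coord_class -imset_comp.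
apply: eq_imset => c /=; rewrite phi_vecZ; congr (c *: _).
by apply/rowP => -[[|[|[|//]]] i3]; rewrite !mxE /= ?mxE /= ?mulr1.
Qed.

(** Subtracting the line equations, [A - C] and [B - C] are both orthogonal to the first two
    coefficients of the line, which do not both vanish. *)
Lemma collinear_det2 A B C :
  collinear (aff A) (aff B) (aff C) -> det2 (A - C) (B - C) = 0.
Proof.
case=> l /imsetP[u]; rewrite inE => u0 ->; rewrite (row3_eta u) !aff_in_line.
case/and3P=> /eqP EA /eqP EB /eqP EC.
have {EA} : u 0 0 * (A.1 - C.1) + u 0 1 * (A.2 - C.2) = 0.
  by rewrite -[RHS]subr0 -{1}EA -EC; ring.
have {EB} : u 0 0 * (B.1 - C.1) + u 0 1 * (B.2 - C.2) = 0.
  by rewrite -[RHS]subr0 -{1}EB -EC; ring.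
rewrite /det2 /=; set x := A.1 - _; set y := A.2 - _; set x' := B.1 - _.
set y' := B.2 - _ => E' E.
have [u1|u1] := eqVneq (u 0 0) 0.
  have u2 : u 0 1 != 0.
    apply: contraNneq u0 => u2; rewrite (row3_eta u) row3_eq0 u1 u2 !eqxx /=.
    by move: EC; rewrite u1 u2 !mul0r !add0r => ->.
  apply: (mulfI u2); rewrite mulr0.
  transitivity (x * (u 0 0 * x' + u 0 1 * y') - x' * (u 0 0 * x + u 0 1 * y)).
    by ring.
  by rewrite E E' !mulr0 subrr.
apply: (mulfI u1); rewrite mulr0.
transitivity ((u 0 0 * x + u 0 1 * y) * y' - y * (u 0 0 * x' + u 0 1 * y')).
  by ring.
by rewrite E E' mul0r mulr0 subrr.
Qed.

Lemma aff_secant A B : A != 0 ->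
  exists2 l, l \in lines F
    & forall C, (aff C \in l) = (det2 (C - B) A == 0).
Proof.
move=> A0; exists (line (row3 A.2 (- A.1) (A.1 * B.2 - A.2 * B.1))).
  apply: line_in_lines; rewrite row3_eq0 oppr_eq0; apply: contraNN A0.
  by case/and3P=> A2 A1 _; rewrite -pair_eqE /pair_eq A1 A2.
move=> C; rewrite aff_in_line /det2 /=; congr (_ == _); ring.
Qed.

End PlaneGeometry.

(** * Translation arcs, hyperovals and subplanes *)

Section TranslationArcs.

Variables (F : finFieldType) (r : nat).
Hypothesis cardF : #|F| = (2 ^ r)%N.
Implicit Types (A B C : F * F) (G : {set F * F}) (P Q : point F).

Lemma sub_add A B : A - B = A + B.
Proof. by rewrite (oppA cardF). Qed.

Lemma translation_orbit_aff G : translation_orbit G (aff 0) = @aff F @: G.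
Proof.
by apply: eq_imset => A /=; rewrite phi_aff add0r.
Qed.

Lemma arc_group_is_arc G : arc_group G -> is_arc (@aff F @: G).
Proof.
case/arc_groupP=> _ GD Gdet _ _ _ /imsetP[A AG ->] /imsetP[B BG ->] /imsetP[C CG ->].
rewrite !(inj_eq (@aff_inj F)) => AB AC BC /collinear_det2; rewrite !sub_add.
case/(Gdet _ _ (GD _ _ AG CG) (GD _ _ BG CG)) => /eqP.
- by rewrite -sub_add subr_eq0 (negPf AC).
- by rewrite -sub_add subr_eq0 (negPf BC).
- by rewrite (inj_eq (addIr C)) (negPf AB).
Qed.

Lemma arc_group_translation_arc G :
  arc_group G -> is_translation_arc (@aff F @: G).
Proof.
move=> aG; have [G0 GD _] := arc_groupP _ aG.
split; first exact: arc_group_is_arc.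
exists G, (aff 0); rewrite translation_orbit_aff aff_finite; split=> //.
by split=> // A B AG BG; rewrite sub_add; apply: GD.
Qed.

Lemma covered_on_secant G C : arc_group G -> covered G C ->
  exists2 l, is_secant (@aff F @: G) l & aff C \in l.
Proof.
case/arc_groupP=> _ GD _ /coveredP[A [B [AG A0 BG dAB]]].
have [l lL lP] := aff_secant B A0; exists l; last by rewrite lP sub_add dAB.
split=> //; exists (aff B), (aff (A + B)); rewrite !lP !imset_f //; last exact: GD.
split=> //.
- by rewrite (inj_eq (@aff_inj F)) -subr_eq0 opprD addrCA subrr addr0 oppr_eq0.
- by rewrite subrr /det2 !mul0r subrr.
- by rewrite addrK /det2 mulrC subrr.
Qed.

(** A further point of [H] off the line at infinity would be collinear with two points of [K]. So
    all further points are at infinity, at most two in number, and [H] has fewer than [#|F| + 2]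
    points. *)
Lemma no_hyperoval K :
    (forall P, P \notin line_infty F -> exists2 l, is_secant K l & P \in l) ->
  (#|K| < #|F|)%N -> ~ (exists2 H, is_hyperoval H & K \subset H).
Proof.
move=> cov ltK [H [cardH arcH] /subsetP KH].
have outK : H :\: K \subset line_infty F.
  apply/subsetP=> P; rewrite inE => /andP[PK PH]; apply: contraT => /cov[l].
  case=> lL [Q [Q' [QK Q'K QQ' Ql Q'l]]] Pl.
  case: (arcH P Q Q' PH (KH _ QK) (KH _ Q'K)) => //.
  - by apply: contraNneq PK => ->.
  - by apply: contraNneq PK => ->.
  - by exists l => //; rewrite Pl Ql.
have d2 : (#|H :\: K| <= 2)%N.
  rewrite leqNgt; apply/card_gt2P=> -[P [Q [Q' [[PH QH Q'H] [PQ QQ' Q'P]]]]].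
  have sH := subsetP (subsetDl H K).
  case: (arcH P Q Q' (sH _ PH) (sH _ QH) (sH _ Q'H)) => //; first by rewrite eq_sym.
  exists (line_infty F); last by rewrite !(subsetP outK).
  by apply: line_in_lines; apply: origin_neq0.
have KH' : K \subset H by apply/subsetP.
by have := leq_add ltK d2; rewrite -cardH -(cardsID K H) (setIidPr KH') addSn ltnn.
Qed.

(** Triples of scalars let concrete incidences reduce to ring identities by computation. *)
Let pt3 (p : F * F * F) : point F := pt (row3 p.1.1 p.1.2 p.2).
Let line3 (l : F * F * F) : {set point F} := line (row3 l.1.1 l.1.2 l.2).
Let dot3 (l p : F * F * F) : F := l.1.1 * p.1.1 + l.1.2 * p.1.2 + l.2 * p.2.
Let dependent (p q : F * F * F) : bool :=
  [&& p.1.1 * q.1.2 == q.1.1 * p.1.2, p.1.1 * q.2 == q.1.1 * p.2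
    & p.1.2 * q.2 == q.1.2 * p.2].

Lemma independent_neq0 p q : ~~ dependent p q -> row3 p.1.1 p.1.2 p.2 != 0.
Proof.
apply: contraNneq => /eqP; rewrite row3_eq0 /dependent.
by case/and3P=> /eqP-> /eqP-> /eqP->; rewrite !mul0r !mulr0 !eqxx.
Qed.

Lemma dependent_sym p q : dependent p q = dependent q p.
Proof.
rewrite /dependent (eq_sym (p.1.1 * q.1.2)) (eq_sym (p.1.1 * q.2)).
by rewrite (eq_sym (p.1.2 * q.2)).
Qed.

Lemma independent_pt p q : ~~ dependent p q -> pt3 p != pt3 q.
Proof.
move=> pq; have p0 := independent_neq0 pq.
have q0 : row3 q.1.1 q.1.2 q.2 != 0.
  by apply: (@independent_neq0 q p); rewrite dependent_sym.
apply: contraNneq pq => /(congr1 (@coords F)); rewrite !coords_pt // => E.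
have : row3 q.1.1 q.1.2 q.2 \in coord_class (row3 p.1.1 p.1.2 p.2).
  by rewrite E; apply/imsetP; exists 1; rewrite ?inE ?oner_eq0 ?scale1r.
case/imsetP=> c _; rewrite scale_row3 => /rowP cE.
have := (cE 0, cE 1, cE 2); rewrite !mxE /= => -[[E1 E2] E3].
by rewrite /dependent E1 E2 E3; apply/and3P; split; apply/eqP; ring.
Qed.

(** A line of the plane joining two points of [S] must be the line of [L] through them. The point of
    [S] common to the two lines is [x], because [dot3 m p != 0] makes them distinct. *)
Lemma subplane_meet S L l m p q p' q' x :
    is_subplane S L -> pt3 p \in S -> pt3 q \in S -> pt3 p' \in S -> pt3 q' \in S ->
    [/\ dot3 l p = 0, dot3 l q = 0, dot3 m p' = 0 & dot3 m q' = 0] ->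
    dot3 l x = 0 /\ dot3 m x = 0 -> ~~ dependent p q -> ~~ dependent p' q' ->
    dot3 m p != 0 -> row3 l.1.1 l.1.2 l.2 != 0 -> row3 x.1.1 x.1.2 x.2 != 0 ->
  pt3 x \in S.
Proof.
case=> /subsetP LL [joinS meetS _] pS qS p'S q'S [lp lq mp' mq'] [lx mx] pq p'q'.
move=> mp l0 x0; have PQ := independent_pt pq; have P'Q' := independent_pt p'q'.
have m0 : row3 m.1.1 m.1.2 m.2 != 0.
  apply: contraNneq mp => /eqP; rewrite row3_eq0 /dot3.
  by case/and3P=> /eqP-> /eqP-> /eqP->; rewrite !mul0r !addr0.
have onl k y : row3 y.1.1 y.1.2 y.2 != 0 -> (pt3 y \in line3 k) = (dot3 k y == 0).
  by move=> y0; rewrite /pt3 /line3 pt_in_line // dot_row3.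
have [p0 p'0] := (independent_neq0 pq, independent_neq0 p'q').
have q0 : row3 q.1.1 q.1.2 q.2 != 0.
  by apply: (@independent_neq0 q p); rewrite dependent_sym.
have q'0 : row3 q'.1.1 q'.1.2 q'.2 != 0.
  by apply: (@independent_neq0 q' p'); rewrite dependent_sym.
have lL : line3 l \in lines F by apply: line_in_lines.
have mL : line3 m \in lines F by apply: line_in_lines.
have inL P Q k : k \in lines F -> P \in S -> Q \in S -> P != Q ->
    P \in k -> Q \in k -> k \in L.
  move=> kL PS QS nPQ Pk Qk; have [k' [[k'L Pk' Qk'] _]] := joinS P Q PS QS nPQ.
  by rewrite (line_unique kL (LL _ k'L) nPQ).
have lm : line3 l != line3 m.
  apply: contraNneq mp => lm; rewrite -onl // -lm onl //; exact/eqP.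
have lSL : line3 l \in L by apply: (inL _ _ _ lL pS qS PQ); rewrite onl ?lp ?lq.
have mSL : line3 m \in L by apply: (inL _ _ _ mL p'S q'S P'Q'); rewrite onl ?mp' ?mq'.
have [R [[RS Rl Rm] _]] := meetS _ _ lSL mSL lm.
have [->//|xR] := eqVneq (pt3 x) R.
by case/eqP: lm; apply: (line_unique lL mL xR); rewrite ?onl ?lx ?mx.
Qed.

(* Starting from the unit square and the point (w, w^2), intersecting lines of the
   subplane produces (w^k, 0) for all k: joining (t, 0) to the point at infinity
   (1, 1, 0) gives (0, t), and the parallel through (w, 0) to the line from (1, 0)
   to (0, t) gives (0, t w). *)
Lemma subplane_full S L w :
    is_subplane S L -> (#|F|.-1).-primitive_root w ->
    (forall A, A \in [:: (0, 0); (1, 0); (0, 1); (1, 1); (w, w ^+ 2)] -> aff A \in S) ->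
  S = [set: point F].
Proof.
move=> SL wP SA; have c2 := addrr_pchar2 (char2 cardF).
have w0 := prim_root_neq0 wP.
have aff3 x y : aff (x, y) = pt3 (x, y, 1) by [].
have OS : pt3 (0, 0, 1) \in S by rewrite -aff3 SA // !inE eqxx.
have E1S : pt3 (1, 0, 1) \in S by rewrite -aff3 SA // !inE eqxx ?orbT.
have E2S : pt3 (0, 1, 1) \in S by rewrite -aff3 SA // !inE eqxx ?orbT.
have ES : pt3 (1, 1, 1) \in S by rewrite -aff3 SA // !inE eqxx ?orbT.
have WS : pt3 (w, w ^+ 2, 1) \in S by rewrite -aff3 SA // !inE eqxx ?orbT.
have zero_one : (0 == 1 :> F) = false by rewrite eq_sym oner_eq0.
have simpl_nz := (mul0r, mulr0, mul1r, mulr1, add0r, addr0, oppr_eq0, oner_eq0,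
  zero_one, row3_eq0, andbF, eqxx, oppr0).
have XS : pt3 (1, 0, 0) \in S.
  apply: (subplane_meet (l := (0, 1, 0)) (m := (0, 1, -1)) SL OS E1S E2S ES);
   rewrite /dot3 /dependent /= ?simpl_nz //; split; ring.
have YS : pt3 (0, 1, 0) \in S.
  apply: (subplane_meet (l := (1, 0, 0)) (m := (1, 0, -1)) SL OS E2S E1S ES);
   rewrite /dot3 /dependent /= ?simpl_nz //; split; ring.
have DS : pt3 (1, 1, 0) \in S.
  apply: (subplane_meet (l := (1, -1, 0)) (m := (1, 1, 1)) SL OS ES E1S E2S);
   rewrite /dot3 /dependent /= ?simpl_nz ?c2 //; split; ring.
have W1S : pt3 (w, 0, 1) \in S.
  apply: (subplane_meet (l := (0, 1, 0)) (m := (1, 0, - w)) SL OS E1S YS WS);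
   rewrite /dot3 /dependent /= ?simpl_nz //; split; ring.
(* In characteristic 2 the line [X_1 + X_2 + t X_3 = 0] contains [(t, 0)], [(0, t)] and the infinite
   point [(1, 1, 0)]. *)
have swap t : t != 0 -> pt3 (t, 0, 1) \in S -> pt3 (0, t, 1) \in S.
  move=> t0 tS.
  apply: (subplane_meet (l := (1, 1, t)) (m := (1, 0, 0)) SL tS DS OS E2S);
   rewrite /dot3 /dependent /= ?simpl_nz ?c2 //; split; ring.
have swapV t : t != 0 -> pt3 (0, t, 1) \in S -> pt3 (t, 0, 1) \in S.
  move=> t0 tS.
  apply: (subplane_meet (l := (1, 1, t)) (m := (0, 1, 0)) SL tS DS OS E1S);
   rewrite /dot3 /dependent /= ?simpl_nz ?c2 //; split; ring.
have mulw t : t != 0 -> pt3 (t, 0, 1) \in S -> pt3 (t * w, 0, 1) \in S.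
  move=> t0 /(swap _ t0) tS; apply: swapV; first exact: mulf_neq0.
  have slopeS : pt3 (1, - t, 0) \in S.
    apply: (subplane_meet (l := (t, 1, - t)) (m := (0, 0, 1)) SL E1S tS XS YS);
     rewrite /dot3 /dependent /= ?simpl_nz //; split; ring.
  apply: (subplane_meet (l := (t, 1, - (t * w))) (m := (1, 0, 0)) SL W1S slopeS OS E2S);
   rewrite /dot3 /dependent /= ?simpl_nz //; split; ring.
have axis x : pt3 (x, 0, 1) \in S.
  have [->//|x0] := eqVneq x 0.
  have [k ->] : exists k, x = w ^+ k.
    have [|k ->] := @prim_rootP _ _ _ wP x; last by exists k.
    apply: (mulfI x0); rewrite mulr1 -exprS prednK ?expf_card //.
    exact: ltnW (finNzRing_gt1 F).
  elim: k => [|k IHk]; first by rewrite expr0.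
  by rewrite exprSr; apply: mulw => //; apply: expf_neq0.
have axis' y : pt3 (0, y, 1) \in S.
  by have [->//|y0] := eqVneq y 0; apply: swap.
have affS x y : pt3 (x, y, 1) \in S.
  apply: (subplane_meet (l := (0, 1, - y)) (m := (1, 0, - x))
            SL XS (axis' y) YS (axis x));
   rewrite /dot3 /dependent /= ?simpl_nz //; split; ring.
have infS c : pt3 (1, c, 0) \in S.
  apply: (subplane_meet (l := (c, -1, 0)) (m := (0, 0, 1)) SL OS (affS 1 c) XS YS);
   rewrite /dot3 /dependent /= ?simpl_nz //; split; ring.
apply/setP=> P; rewrite inE.
have [Pinf|/aff_surj[[x y] ->]] := boolP (P \in line_infty F); last first.
  exact: affS.
have [v v0 PE] := pt_surj P; rewrite PE in Pinf *; move: Pinf (v0).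
rewrite pt_in_line // (row3_eta v) dot_row3 !mul0r !add0r mul1r => /eqP ->.
have [->|v1] := eqVneq (v 0 0) 0.
  rewrite row3_eq0 !eqxx andbT /= => v2.
  rewrite -(ptZ (invr_neq0 v2)) ?row3_eq0 ?eqxx ?andbT //.
  by rewrite scale_row3 !mulr0 mulVf.
rewrite -(ptZ (invr_neq0 v1)) ?row3_eq0 ?(negPf v1) // => _.
by rewrite scale_row3 mulr0 mulVf //; apply: infS.
Qed.

End TranslationArcs.

Theorem theorem3p8 (F : finFieldType) (r : nat)
  (cardF : #|F| = (2 ^ r)%N)
  (hr : exists s : nat, (s %| r)%N /\ (2 < s < r)%N) :
  exists K : {set point F},
    [/\ is_translation_arc K,
        forall P : point F, P \notin line_infty F ->
          exists2 l : {set point F}, is_secant K l & P \in l,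
        ~ (exists2 H : {set point F}, is_hyperoval H & K \subset H)
      & ~ (exists (S : {set point F}) (L : {set {set point F}}),
             is_proper_subplane S L /\ K \subset S)].
Proof.
(* A proper multiple [r] of some [s >= 3] is at least 6. *)
have q64 : (64 <= #|F|)%N.
  rewrite cardF (@leq_exp2l 2 6) //; case: hr => s [/dvdnP[k ->] /andP[s2 sk]].
  by case: k sk => [|[|k]] //; rewrite ?mul1n ?ltnn // mulSn mulSn; lia.
have [w wP] := finField_primitive F.
have w4 : w ^+ 4 != w.
  apply/eqP => w4; have w0 := prim_root_neq0 wP.
  have : (#|F|.-1 %| 3)%N.
    by rewrite (prim_order_dvd wP); apply/eqP/(mulfI w0); rewrite -exprS mulr1.
  by move/dvdn_leq => /(_ isT); lia.
have [|G0 [v [aG0 e1 e2 wG [vG v0 v1 vw vw1]]]] := exists_small_arc_group cardF _ w4.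
  by apply: leq_trans q64.
have [G maxG sG0G] := maxset_exists aG0.
have aG : arc_group G by case/maxsetP: maxG.
have sG := subsetP sG0G.
have w0 := prim_root_neq0 wP.
have w1 : w != 1 by apply: contraNneq w4 => ->; rewrite expr1n.
have covG A : covered G A.
  have e10 : (1, 0) != 0 :> F * F.
    by apply/eqP => /(congr1 fst) /eqP; rewrite oner_eq0.
  exact (maximal_covers cardF A maxG (sG _ e1) e10).
exists (@aff F @: G).
have cov P : P \notin line_infty F ->
    exists2 l, is_secant (@aff F @: G) l & P \in l.
  by case/aff_surj=> A ->; apply: (covered_on_secant cardF aG).
split=> //; first exact: (arc_group_translation_arc cardF).
  apply: no_hyperoval => //; rewrite card_imset; last exact: aff_inj.
  apply: (card_arc_group_lt cardF (w := w) (v := v) aG); rewrite ?sG //.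
  by apply: leq_trans q64.
case=> S [L [[SL pS] /subsetP KS]].
have [GO GD _] := arc_groupP _ aG.
move: pS; rewrite (subplane_full cardF SL wP) ?properxx // => A.
rewrite !inE => AE; apply/KS/imset_f; case/or4P: AE => [/eqP->|/eqP->|/eqP->|] //;
  try exact: sG.
case/orP=> /eqP->; last exact: sG.
have -> : (1, 1) = (1, 0) + (0, 1) :> F * F.
  by apply/pair_eqP; rewrite /= addr0 add0r !eqxx.
by apply: GD; apply: sG.
Qed.
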